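(* Let $a,b,k$ be integers with $b>a\ge 1$ and $k\ge 0$, and let $G$ be a connected graph of order $n\ge 4a+\frac{5b}{2}+4k+7$ with minimum degree $\delta(G)\ge a+k$. If $$e(G)\ge \binom{n-b-1}{2}+ab+2a+(b+1)k,$$ then $G$ is an $(a,b,k)$-critical graph.
   Context: All graphs are finite, simple and undirected; $e(G)$ is the number of edges of $G$. For positive integers $b\ge a$, an $[a,b]$-factor of $G$ is a spanning subgraph $H$ with $a\le d_H(v)\le b$ for every vertex $v$. A graph $G$ is $(a,b,k)$-critical if for every set $X$ of $k$ vertices of $G$, the graph $G-X$ has an $[a,b]$-factor. *)

(* Defs.v *)
From mathcomp Require Import all_boot all_order all_algebra.

Set Implicit Arguments.
Unset Strict Implicit.
Unset Printing Implicit Defensive.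

Record sgraph (V : finType) := SGraph {
  adj :> rel V;
  adj_sym : symmetric adj;
  adj_irr : irreflexive adj
}.

Section SGraphTheory.
Variable V : finType.
Implicit Types (G H : sgraph V) (X : {set V}) (a b k : nat).

Definition edges G : {set {set V}} :=
  [set [set x; y] | x in V, y in adj G x].

Definition degree G (v : V) : nat := #|[set w | adj G v w]|.

(* Every degree is smaller than #|V|, so the default value #|V| is irrelevant
   as soon as V is nonempty. *)
Definition min_degree G : nat := \big[minn/#|V|]_(v : V) degree G v.

Definition connected G : Prop := forall x y : V, connect (adj G) x y.

Definition spanning_subgraph H G : Prop := subrel (adj H) (adj G).

Definition is_factor a b G H : Prop :=
  spanning_subgraph H G /\ forall v : V, a <= degree H v <= b.

Section Deletion.
Variables (G : sgraph V) (X : {set V}).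

Definition del_rel : rel {x : V | x \notin X} :=
  fun u v => adj G (val u) (val v).

Lemma del_rel_sym : symmetric del_rel.
Proof. by move=> u v; rewrite /del_rel adj_sym. Qed.

Lemma del_rel_irr : irreflexive del_rel.
Proof. by move=> u; rewrite /del_rel adj_irr. Qed.

Definition del_vertices : sgraph {x : V | x \notin X} :=
  SGraph del_rel_sym del_rel_irr.

End Deletion.
End SGraphTheory.

Definition has_factor (V : finType) (a b : nat) (G : sgraph V) : Prop :=
  exists H : sgraph V, is_factor a b G H.

Definition critical (V : finType) (a b k : nat) (G : sgraph V) : Prop :=
  forall X : {set V}, #|X| = k -> has_factor a b (del_vertices G X).

(* Main.v *)
(** Deleting a k-set [X] costs at most [k (n - k) + 'C(k, 2)] edges and at most
    [k] in each degree, which turns the hypotheses into those of the case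
    [k = 0] for [G - X].  Since [a < b], a graph has an [[a, b]]-factor as soon
    as [a |T| <= b |S| + sum_(x in T) d_(G - S)(x)] for all disjoint [S], [T]
    (Lovász): otherwise take a spanning subgraph [H] and a vertex whose degree
    leaves [[a, b]]; the vertices reached from it by alternating walks either
    allow an exchange that brings the degrees closer to [[a, b]], or form a
    pair [S], [T] violating the inequality.  If [S], [T] violate it in [G - X],
    the minimum degree forces [|T| > b], and counting the edges that meet [T]
    contradicts the bound on the number of edges. *)
Require Import Defs.
From mathcomp Require Import all_boot all_order all_algebra.
From mathcomp Require Import zify lra.
From Stdlib Require Import ZArith Lia.

Set Implicit Arguments.
Unset Strict Implicit.
Unset Printing Implicit Defensive.

(** * Degrees into a vertex set *)

Definition deg_in (V : finType) (e : rel V) (A : {set V}) (x : V) : nat :=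
  \sum_(y in A) e x y.

Lemma degreeE (V : finType) (H : sgraph V) (x : V) :
  degree H x = \sum_y H x y.
Proof.
rewrite /degree -sum1dep_card big_mkcond /=.
by apply: eq_bigr => y _; case: (H x y).
Qed.

Lemma sum_deg_in_sym (V : finType) (e : rel V) (A B : {set V}) :
  symmetric e -> \sum_(x in A) deg_in e B x = \sum_(x in B) deg_in e A x.
Proof.
move=> e_sym; rewrite /deg_in exchange_big /=.
by apply: eq_bigr => x _; apply: eq_bigr => y _; rewrite e_sym.
Qed.

(** * Switching one edge in or out of a subgraph *)

Section Flip.
Variables (V : finType) (H : sgraph V) (x y : V) (neq_xy : x != y).

Definition flip_rel : rel V := fun u w =>
  H u w (+) ((u == x) && (w == y) || (u == y) && (w == x)).

Lemma flip_rel_sym : symmetric flip_rel.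
Proof.
by move=> u w; rewrite /flip_rel adj_sym orbC [(u == y) && _]andbC
  [(u == x) && _]andbC.
Qed.

Lemma flip_rel_irr : irreflexive flip_rel.
Proof.
move=> u; rewrite /flip_rel adj_irr /= [(u == y) && _]andbC orbb.
by case: eqP => // ->; rewrite (negbTE neq_xy).
Qed.

Definition flip : sgraph V := SGraph flip_rel_sym flip_rel_irr.

Lemma degree_flip_l : degree flip x + H x y = degree H x + ~~ H x y.
Proof.
rewrite !degreeE (bigD1 y) // [in RHS](bigD1 y) //=.
rewrite (eq_bigr (fun w => nat_of_bool (H x w))); last first.
  move=> w /negbTE nwy; rewrite /flip_rel nwy andbF (negbTE neq_xy) /=.
  by rewrite addbF.
by rewrite /flip_rel !eqxx /= addbT; lia.
Qed.

Lemma degree_flip_r : degree flip y + H x y = degree H y + ~~ H x y.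
Proof.
rewrite !degreeE (bigD1 x) // [in RHS](bigD1 x) //=.
rewrite (eq_bigr (fun w => nat_of_bool (H y w))); last first.
  move=> w /negbTE nwx; rewrite /flip_rel nwx andbF [y == x]eq_sym.
  by rewrite (negbTE neq_xy) /= addbF.
by rewrite /flip_rel !eqxx /= orbT addbT [H y x]adj_sym; lia.
Qed.

Lemma degree_flip_out z : z != x -> z != y -> degree flip z = degree H z.
Proof.
move=> /negbTE zx /negbTE zy; rewrite !degreeE; apply: eq_bigr => w _ /=.
by rewrite /flip_rel zx zy addbF.
Qed.

Lemma flip_sub (G : sgraph V) :
  spanning_subgraph H G -> G x y -> spanning_subgraph flip G.
Proof.
move=> sHG Gxy u w /=; rewrite /flip_rel.
case: orP => [[] /andP[/eqP-> /eqP->] // _|_].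
  by rewrite adj_sym.
by rewrite addbF; apply: sHG.
Qed.

End Flip.

(** * The factor criterion, by alternating walks *)

Section Criterion.
Variables (V : finType) (a b : nat) (G : sgraph V).
Hypothesis lt_ab : a < b.

(** Truncated subtraction makes each summand the distance from the degree to [[a, b]]. *)
Definition imbalance (H : sgraph V) : nat :=
  \sum_v ((a - degree H v) + (degree H v - b)).

(* In a state [(x, s)], the next edge out of [x] must lie in [H] iff [s]. *)
Definition alt_step (H : sgraph V) : rel (V * bool) := fun u w =>
  [&& G u.1 w.1, H u.1 w.1 == u.2 & w.2 == ~~ u.2].

(** Flipping the next edge of the walk moves a needy vertex towards [[a, b]]. *)
Definition needy (H : sgraph V) (u : V * bool) : bool :=
  if u.2 then b < degree H u.1 else degree H u.1 < a.

(** A walk enters a state [(y, s)] by an edge outside [H] iff [s]; slack means that [y] can absorb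
    the flip of that edge at no cost. *)
Definition slack (H : sgraph V) (u : V * bool) : bool :=
  if u.2 then degree H u.1 < b else a < degree H u.1.

(** The flip brings [x] one closer to [[a, b]] and costs [y] at most one, or nothing if [y] has
    slack. *)
Lemma imbalance_flip (H : sgraph V) x y (neq_xy : x != y) :
  needy H (x, H x y) ->
  imbalance (flip H neq_xy) + slack H (y, ~~ H x y) <= imbalance H.
Proof.
move=> needx; rewrite /imbalance (bigD1 x) //= (bigD1 y) 1?eq_sym //=.
rewrite [leqRHS](bigD1 x) //= [in leqRHS](bigD1 y) 1?eq_sym //=.
rewrite (eq_bigr (fun v => (a - degree H v) + (degree H v - b))); last first.
  by move=> v /andP[vx vy]; rewrite degree_flip_out.
have := degree_flip_l H neq_xy; have := degree_flip_r H neq_xy.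
move: needx; rewrite /needy /slack /=; case: (H x y) => /=; lia.
Qed.

Lemma needy_slackF (H : sgraph V) u : needy H u -> ~~ slack H u.
Proof. by case: u => x []; rewrite /needy /slack /=; lia. Qed.

(** Both fail only if [b <= degree H x <= a]. *)
Lemma slack_or (H : sgraph V) x s : slack H (x, s) || slack H (x, ~~ s).
Proof. by case: s; rewrite /slack /=; lia. Qed.

Lemma path_in_belast (T : eqType) (e e' : rel T) x p :
  (forall y z, y \in belast x p -> z \in p -> e y z -> e' y z) ->
  path e x p -> path e' x p.
Proof.
elim: p x => //= y p IH x ee' /andP[exy ep].
rewrite ee' ?mem_head //=; apply: IH => // z w zp wp.
by apply: ee'; rewrite inE ?zp ?wp orbT.
Qed.

(* Flip the first edge [xy] of a walk without repeated states: [y] is then needy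
   for the rest of the walk, which is still alternating because no later step
   uses [xy], as long as the walk is cut at its first slack state. *)
Lemma augment n (H : sgraph V) u p :
  spanning_subgraph H G -> size p < n -> path (alt_step H) u p ->
  needy H u -> slack H (last u p) ->
  exists2 H', spanning_subgraph H' G & imbalance H' < imbalance H.
Proof.
elim: n H u p => // n IH H u p sHG size_p path_p need_u.
case/shortenP: path_p => p' path_p' uniq_p' sub_p' slack_p'.
have {size_p sub_p' p} : size p' < n.+1.
  apply: leq_ltn_trans size_p; apply: uniq_leq_size => //.
  by case/andP: uniq_p'.
case: p' path_p' uniq_p' slack_p' => [|v q] /=.
  by move=> _ _ slack_u; case/negP: (needy_slackF need_u).
move=> /andP[uv path_q] /andP[u_notin _] slack_q size_q.
have [/hasP[w w_in slack_w] | no_slack] := boolP (has (slack H) (belast v q)).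
  have path_vq : path (alt_step H) u (rcons (belast v q) (last v q)).
    by rewrite -lastI /= uv.
  have := size_belast v q.
  case/splitPr: w_in path_vq => r1 r2.
  rewrite -cats1 -catA cat_cons -cat_rcons cat_path size_cat /=.
  move=> /andP[path_r _] size_r.
  apply: (IH H u (rcons r1 w)); rewrite ?last_rcons ?size_rcons //.
  by move: size_q size_r; lia.
move: u v need_u uv path_q u_notin slack_q no_slack.
move=> [x s] [y s'] need_u uv path_q u_notin slack_q no_slack.
case/and3P: uv => /= Gxy /eqP Hxy /eqP s'E.
rewrite {s'}s'E -{s}Hxy in need_u path_q u_notin slack_q no_slack *.
have neq_xy : x != y by apply: contraTneq Gxy => ->; rewrite adj_irr.
have := imbalance_flip neq_xy need_u.
have sH'G := @flip_sub _ _ _ _ neq_xy _ sHG Gxy.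
case: q => [|z q] in path_q u_notin slack_q no_slack size_q *.
  by move: slack_q => /= -> ?; exists (flip H neq_xy); rewrite // -addn1.
move=> le_imb.
have nslack_y : ~~ slack H (y, ~~ H x y).
  by apply: contra no_slack => /= ->.
have [] := IH (flip H neq_xy) (y, ~~ H x y) (z :: q) => //.
- apply: path_in_belast path_q => -[w t] [w' t'] w_in _ /and3P[/= Gw Hw tE].
  apply/and3P; split=> //=; rewrite /flip_rel.
  (* A later step from [x] to [y] would repeat the starting state; one from [y] to [x] would leave
     the state [(y, H x y)], which is slack by [slack_or]. *)
  case: orP => [[] /andP[/eqP wE /eqP w'E]|_]; last by rewrite addbF.
    rewrite {}wE {}w'E in w_in Hw.
    by rewrite -(eqP Hw) in w_in; rewrite (mem_belast w_in) in u_notin.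
  rewrite {}wE {}w'E in w_in Hw; rewrite adj_sym in Hw.
  move/hasPn: no_slack => /(_ _ w_in); rewrite -(eqP Hw).
  by move: (slack_or H y (H x y)); rewrite (negbTE nslack_y) orbF => ->.
- move: nslack_y; have := degree_flip_r H neq_xy.
  by rewrite /slack /needy /=; case: (H x y) => /=; lia.
(* The end stays slack: at [x] because [a < b], at [y] because its only possible slack is in the
   direction that the flip enlarges. *)
- move: slack_q => /=; case: (last z q) => w t; move: need_u nslack_y.
  have := degree_flip_r H neq_xy; have := degree_flip_l H neq_xy.
  rewrite /slack /needy /=.
  have [->|wx] := eqVneq w x; first by case: (H x y) t => [] [] /=; lia.
  have [->|wy] := eqVneq w y; first by case: (H x y) t => [] [] /=; lia.
  by move=> _ _ _ _; rewrite degree_flip_out.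
move=> H' sH' lt_imb; exists H' => //; apply: leq_trans lt_imb _.
by apply: leq_trans le_imb; apply: leq_addr.
Qed.

Lemma degree_deg_in (H : sgraph V) A x :
  deg_in H A x + deg_in H (~: A) x = degree H x.
Proof.
rewrite degreeE [RHS](bigID (mem A)) /=; congr (_ + _).
by apply: eq_bigl => y; rewrite inE.
Qed.

Lemma imbalance_descent (H : sgraph V) :
  (forall S T : {set V}, [disjoint S & T] ->
     a * #|T| <= b * #|S| + \sum_(x in T) deg_in G (~: S) x) ->
  spanning_subgraph H G -> 0 < imbalance H ->
  exists2 H', spanning_subgraph H' G & imbalance H' < imbalance H.
Proof.
move=> crit sHG; rewrite lt0n sum_nat_eq0 negb_forall => /existsP[v imb_v].
have [s need_v] : exists s, needy H (v, s).
  move: imb_v; rewrite /needy implyTb.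
  case: (ltnP (degree H v) a) => [? _|? ?].
    by exists false.
  by exists true => /=; lia.
pose R z := connect (alt_step H) (v, s) z.
case: (boolP [exists z, R z && slack H z]) => [/existsP[z /andP[]]|].
  case/connectP => p path_p -> slack_p.
  exact: (@augment (size p).+1 H (v, s) p).
rewrite negb_exists => /forallP nslack; exfalso.
have {}nslack z : R z -> ~~ slack H z.
  by move=> Rz; move: (nslack z); rewrite Rz.
pose S := [set x | R (x, true)]; pose T := [set x | R (x, false)].
have Sdeg x : x \in S -> b <= degree H x.
  by rewrite inE => /nslack; rewrite /slack /= -leqNgt.
have Tdeg x : x \in T -> degree H x <= a.
  by rewrite inE => /nslack; rewrite /slack /= -leqNgt.
have dST : [disjoint S & T].
  rewrite disjoint_subset; apply/subsetP => x xS; rewrite !inE.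
  apply: contraL (Sdeg x xS) => xT; rewrite -ltnNge.
  by apply: leq_ltn_trans lt_ab; apply: Tdeg; rewrite inE.
(* [T] and [S] are closed under alternating steps: edges of [G] outside [H] lead from [T] to [S],
   edges of [H] lead from [S] to [T]. *)
have RT x y : x \in T -> G x y -> ~~ H x y -> y \in S.
  rewrite !inE => Rx Gxy /negbTE Hxy; apply: connect_trans Rx (connect1 _).
  by rewrite /alt_step /= Gxy Hxy.
have RS x y : x \in S -> H x y -> y \in T.
  rewrite !inE => Rx Hxy; apply: connect_trans Rx (connect1 _).
  by rewrite /alt_step /= sHG // Hxy.
have degT x : x \in T -> deg_in G (~: S) x <= deg_in H (~: S) x.
  move=> xT; apply: leq_sum => y; rewrite inE => yS.
  case: (boolP (G x y)) => // Gxy; case: (boolP (H x y)) => // Hxy.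
  by rewrite (RT x y) in yS.
have degS x : x \in S -> deg_in H T x = degree H x.
  move=> xS; rewrite -(degree_deg_in H T) [X in _ + X]big1 ?addn0 // => y.
  by rewrite inE; case: (boolP (H x y)) => // /RS-> //.
have sumT : \sum_(x in T) deg_in G (~: S) x + \sum_(x in S) degree H x
            <= \sum_(x in T) degree H x.
  rewrite -(eq_bigr _ degS) (sum_deg_in_sym _ _ (adj_sym H)) -big_split /=.
  apply: leq_sum => x xT; rewrite -(degree_deg_in H S) addnC leq_add2l.
  exact: degT.
have sumTa : \sum_(x in T) degree H x <= a * #|T|.
  by rewrite mulnC -sum_nat_const; apply: leq_sum.
have sumSb : b * #|S| <= \sum_(x in S) degree H x.
  by rewrite mulnC -sum_nat_const; apply: leq_sum.
have Rv : R (v, s) by apply: connect0.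
have := crit S T dST; rewrite /needy /= in need_v.
(* The needy start [v] makes the degree bound strict on its side, against [crit]. *)
case Es: s need_v => need_v.
  suff : b * #|S| < \sum_(x in S) degree H x by lia.
  have vS : v \in S by rewrite inE -Es.
  rewrite mulnC -sum_nat_const (bigD1 v) //= [ltnRHS](bigD1 v) //= -addSn.
  by apply: leq_add => //; apply: leq_sum => x /andP[/Sdeg].
suff : \sum_(x in T) degree H x < a * #|T| by lia.
have vT : v \in T by rewrite inE -Es.
rewrite mulnC -sum_nat_const (bigD1 v) //= [ltnRHS](bigD1 v) //= -addSn.
by apply: leq_add => //; apply: leq_sum => x /andP[/Tdeg].
Qed.

Lemma factor_criterion :
  (forall S T : {set V}, [disjoint S & T] ->
     a * #|T| <= b * #|S| + \sum_(x in T) deg_in G (~: S) x) ->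
  has_factor a b G.
Proof.
move=> crit.
have descend n (H : sgraph V) : spanning_subgraph H G -> imbalance H < n ->
    has_factor a b G.
  elim: n H => // n IH H sHG; rewrite ltnS => le_n.
  have [imb0|imb_gt0] := posnP (imbalance H); last first.
    have [H' sH' lt_imb] := imbalance_descent crit sHG imb_gt0.
    by apply: IH sH' _; apply: leq_trans lt_imb le_n.
  exists H; split=> // v; move/eqP: imb0; rewrite sum_nat_eq0.
  by move/forallP=> /(_ v); rewrite implyTb; lia.
(* The descent starts from the edgeless graph. *)
have sym0 : symmetric (fun _ _ : V => false) by [].
have irr0 : irreflexive (fun _ : V => fun _ : V => false) by [].
by apply: (descend _ (SGraph sym0 irr0)) => //; apply: ltnSn.
Qed.

End Criterion.

(** * Edges and degree sums, also under vertex deletion *)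

Lemma double_edges_le (V : finType) (G : sgraph V) :
  2 * #|edges G| <= \sum_x degree G x.
Proof.
pose A := [set p : V * V | G p.1 p.2].
have -> : \sum_x degree G x = \sum_(p in A) 1.
  under eq_bigr => x _ do rewrite /degree -sum1dep_card.
  by rewrite pair_big_dep; apply: eq_bigl => p; rewrite inE.
have edgesE : edges G = [set [set p.1; p.2] | p in A].
  apply/setP => e; apply/imset2P/imsetP => [[x y _ Gxy ->]|[[x y] Gxy ->]].
    by exists (x, y); rewrite ?inE.
  by exists x y; rewrite inE in Gxy.
rewrite (partition_big_imset (fun p : V * V => [set p.1; p.2])) -edgesE /=.
rewrite mulnC -sum_nat_const; apply: leq_sum => e; rewrite edgesE.
case/imsetP => -[x y]; rewrite inE /= => Gxy ->.
have neq_xy : x != y by apply: contraTneq Gxy => ->; rewrite adj_irr.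
(* The fibre over an edge contains two distinct ordered pairs. *)
rewrite (bigD1 (x, y)) ?inE /= ?Gxy ?eqxx // (bigD1 (y, x)) //=.
rewrite inE /= adj_sym Gxy setUC eqxx /=.
by apply: contraNneq neq_xy => -[->].
Qed.

Lemma degree_le_min (V : finType) (G : sgraph V) v :
  min_degree G <= degree G v.
Proof.
rewrite /min_degree; elim: (index_enum V) (mem_index_enum v) => // x r IH.
rewrite inE big_cons => /orP[/eqP->|/IH le_r]; first exact: geq_minl.
by apply: leq_trans le_r; apply: geq_minr.
Qed.

Section Deletion.
Variables (V : finType) (G : sgraph V) (X : {set V}).
Notation G' := (del_vertices G X).

Lemma sum_deleted (F : V -> nat) :
  \sum_(u : {x : V | x \notin X}) F (val u) = \sum_(x | x \notin X) F x.
Proof. by rewrite -(big_sub [pred x | x \notin X] F). Qed.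

Lemma degree_deleted (u : {x : V | x \notin X}) :
  degree G (val u) = degree G' u + deg_in G X (val u).
Proof.
rewrite !degreeE (sum_deleted (fun y => nat_of_bool (G (val u) y))).
by rewrite addnC (bigID (mem X)).
Qed.

Lemma card_deleted : #|{: {x : V | x \notin X}}| + #|X| = #|V|.
Proof. by rewrite card_sig -(cardC X) addnC. Qed.

(** Each vertex outside [X] loses at most [#|X|]; each vertex of [X] has degree at most
    [#|V| - 1]. *)
Lemma sum_degree_deleted :
  \sum_x degree G x <=
  \sum_u degree G' u + #|X| * (#|V| - #|X|) + #|X| * (#|V| - 1).
Proof.
have degV x : degree G x <= #|V| - 1.
  rewrite subn1 -(cardC1 x); apply/subset_leq_card/subsetP => y.
  by rewrite !inE; apply: contraTneq => ->; rewrite adj_irr.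
rewrite (bigID (mem X)) /= addnC -(sum_deleted (degree G)).
rewrite (eq_bigr _ (fun u _ => degree_deleted u)).
rewrite big_split /= (sum_deleted (deg_in G X)).
rewrite -(sum_nat_const (mem X) (#|V| - 1)).
apply: leq_add; last by apply: leq_sum => x _; apply: degV.
rewrite leq_add2l.
have -> : #|V| - #|X| = #|~: X| by rewrite -(cardsC X) addKn.
rewrite mulnC -sum_nat_const big_mkcond [leqRHS]big_mkcond /=.
apply: leq_sum => x _; rewrite inE; case: ifP => // _.
by rewrite -sum1_card; apply: leq_sum => y _; case: (G x y).
Qed.

End Deletion.

(** * The edge count as a polynomial inequality *)

Section Arithmetic.
Local Open Scope Z_scope.

(* The left-hand side is [(a + b)^2] times the difference of the two sides
   of [edge_count_lt] at [t = b n / (a + b)], [s = a n / (a + b)].  After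
   substituting [a = x + 1], [b = a + 1 + d], [2 n = 8 a + 5 b + 14 + m] all
   its coefficients are negative. *)
Lemma edge_count_peak_neg (a b n : Z) :
  1 <= a -> a < b -> 8 * a + 5 * b + 14 <= 2 * n ->
  - n * n * b * b + n * (a + b) * ((2 * b + 3) * (a + b) - a)
  - (a + b) * (a + b) * ((b + 1) * (b + 2) + 2 * a * b + 4 * a + 2) < 0.
Proof.
move=> a1 ab hn.
have [x [x0 ax]] : exists x, 0 <= x /\ a = x + 1 by exists (a - 1); lia.
have [d [d0 bd]] : exists d, 0 <= d /\ b = a + 1 + d by exists (b - a - 1); lia.
have [m [m0 nm]] : exists m, 0 <= m /\ 2 * n = 8 * a + 5 * b + 14 + m.
  by exists (2 * n - (8 * a + 5 * b + 14)); lia.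
(* The factor 4 makes [n] occur only as [2 * n]. *)
suff : - (2 * n) * (2 * n) * b * b
  + 2 * (2 * n) * (a + b) * ((2 * b + 3) * (a + b) - a)
  - 4 * (a + b) * (a + b) * ((b + 1) * (b + 2) + 2 * a * b + 4 * a + 2) < 0.
  by nia.
rewrite nm bd ax; nia.
Qed.

(** With [s = #|S|] and [t = #|T|] for a violating pair, the left side bounds the degree sum; the
    right side is twice the required number of edges. *)
Lemma edge_count_lt (a b n s t : Z) :
  1 <= a -> a < b -> 8 * a + 5 * b + 14 <= 2 * n -> 0 <= s -> b < t ->
  s <= n - t -> b * s < a * t ->
  (n - t) * (n - t - 1) + 2 * (s * t + a * t - b * s - 1)
  < (n - b - 1) * (n - b - 2) + 2 * a * b + 4 * a.
Proof.
move=> a1 ab hn s0 bt su bs; apply/Z.nle_gt => le_count.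
have peak := edge_count_peak_neg a1 ab hn.
have [tb|tb] : t = b + 1 \/ b + 2 <= t by lia.
  (* This case is tight: at [s = a] only the final [- 1] gives strictness. *)
  subst t; have : s <= a by nia.
  nia.
have [ct|ct] : (a + b) * t <= b * n \/ b * n < (a + b) * t by lia.
  (* [b s < a t] bounds the count by a convex quadratic in [t], negative at
     [b + 2] and at [b n / (a + b)]. *)
  pose Q z := b * (n - z) * (n - z - 1) + 2 * (a * z - 1) * z
              - b * ((n - b - 1) * (n - b - 2) + 2 * a * b + 4 * a).
  (* [Q] is [b] times the difference of the two sides with [b * s] raised to [a * t - 1]. *)
  have Qt : 0 <= Q t.
    have h1 : b * s * (t - b) <= (a * t - 1) * (t - b) by nia.
    have h2 := Z.mul_le_mono_nonneg_l _ _ b ltac:(lia) le_count.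
    by rewrite /Q; nia.
  have Qb : Q (b + 2) < 0 by rewrite /Q; nia.
  (* [L z] is the slope of the chord of [Q] from [b + 2] to [z]. It increases with [z], so the sign
     of [Q t] carries over to [b n / c], where [c * L] takes the value [B]. *)
  pose L z := (b + 2 * a) * (z + b + 2) - b * (2 * n - 1) - 2.
  have QE z : Q z = (z - (b + 2)) * L z + Q (b + 2) by rewrite /Q /L; ring.
  have Lt : 0 <= L t by move: Qt; rewrite (QE t); nia.
  set c := a + b in peak ct *.
  have c0 : 0 < c by rewrite /c; lia.
  have ub1 : 0 <= c * (t - (b + 2)) <= b * n - c * (b + 2) by nia.
  pose B := (b + 2 * a) * (b * n + c * (b + 2)) - c * (b * (2 * n - 1) + 2).
  have ub2 : 0 <= c * L t <= B.
    split; first by nia.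
    have : (b + 2 * a) * (c * t) <= (b + 2 * a) * (b * n).
      by apply: Z.mul_le_mono_nonneg_l => //; lia.
    by rewrite /L /B; nia.
  have ub3 := Z.mul_le_mono_nonneg _ _ _ _ (proj1 ub1) (proj2 ub1)
    (proj1 ub2) (proj2 ub2).
  have Qc : 0 <= (b * n - c * (b + 2)) * B + c * c * Q (b + 2).
    have : 0 <= c * c * Q t.
      by apply: Z.mul_nonneg_nonneg => //; apply: Z.mul_nonneg_nonneg; lia.
    have -> : c * c * Q t = c * (t - (b + 2)) * (c * L t) + c * c * Q (b + 2).
      by rewrite (QE t); ring.
    by lia.
  have eq : (b * n - c * (b + 2)) * B + c * c * Q (b + 2)
    = b * (- n * n * b * b + n * c * ((2 * b + 3) * c - a)
           - c * c * ((b + 1) * (b + 2) + 2 * a * b + 4 * a + 2)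
           - 2 * c * (n - c)).
    by rewrite /Q /B /c; ring.
  have nc : 0 <= 2 * c * (n - c).
    by rewrite /c in c0 *; apply: Z.mul_nonneg_nonneg; lia.
  move: Qc; rewrite eq => /Z.nlt_ge; apply.
  by apply: Z.mul_pos_neg; lia.
(* Past that point [s <= n - t] gives a bound increasing in [u = n - t], with
   [u < a n / (a + b)]. *)
pose u := n - t; have tE : t = n - u by rewrite /u; lia.
move: su bs le_count; rewrite tE; have -> : n - (n - u) = u by lia.
move=> su bs le_count.
set c := a + b in peak ct *.
have c0 : 0 < c by rewrite /c; lia.
have uc : c * u < a * n by rewrite /c tE in ct *; nia.
pose M := 2 * n - 2 * c - 1.
have F : 0 <= - u * u + u * M + 2 * a * n - 2
      - ((n - b - 1) * (n - b - 2) + 2 * a * b + 4 * a).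
  have : s * (n - u - b) <= u * (n - u - b).
    by apply: Z.mul_le_mono_nonneg_r; lia.
  by rewrite /M /c; lia.
(* This product is [c * c] times the growth of [- u * u + u * M] from [u] to [a n / c]. *)
have mono : 0 <= (a * n - c * u) * (c * M - c * u - a * n).
  apply: Z.mul_nonneg_nonneg; first by lia.
  have : 2 * a * n <= c * n by apply: Z.mul_le_mono_nonneg_r; rewrite /c; lia.
  have : c * n <= c * M.
    by apply: Z.mul_le_mono_nonneg_l; rewrite /M /c in c0 *; lia.
  by lia.
have Fc := Z.mul_nonneg_nonneg (c * c) _ (Z.square_nonneg c) F.
have eq : c * c * (- u * u + u * M + 2 * a * n - 2
      - ((n - b - 1) * (n - b - 2) + 2 * a * b + 4 * a))
      + (a * n - c * u) * (c * M - c * u - a * n)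
   =  - n * n * b * b + n * c * ((2 * b + 3) * c - a)
  - c * c * ((b + 1) * (b + 2) + 2 * a * b + 4 * a + 2) by rewrite /M /c; ring.
by lia.
Qed.

End Arithmetic.

(** * From the counts to factors and criticality *)

Lemma factor_of_many_edges (V : finType) (a b : nat) (G : sgraph V) :
  0 < a -> a < b -> 8 * a + 5 * b + 14 <= 2 * #|V| ->
  (forall v, a <= degree G v) ->
  2 * ('C(#|V| - b - 1, 2) + a * b + 2 * a) <= \sum_x degree G x ->
  has_factor a b G.
Proof.
move=> a_gt0 lt_ab hn degG sumG; apply: factor_criterion => // S T dST.
rewrite leqNgt; apply/negP => viol.
have cT := cardsC T.
have leST : #|S| <= #|~: T|.
  apply/subset_leq_card/subsetP => x xS; rewrite inE.
  by rewrite (disjointFr dST xS).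
have degS x : deg_in G S x <= #|S|.
  by rewrite -sum1_card; apply: leq_sum => y _; case: (G x y).
have sumTS : \sum_(x in T) degree G x
             <= #|S| * #|T| + \sum_(x in T) deg_in G (~: S) x.
  rewrite mulnC -sum_nat_const -big_split /=; apply: leq_sum => x _.
  by rewrite -(degree_deg_in G S) leq_add2r.
have sumTa : a * #|T| <= \sum_(x in T) degree G x.
  by rewrite mulnC -sum_nat_const; apply: leq_sum.
(* [viol], [sumTS] and [sumTa] give [b * #|S| < #|S| * #|T|]. *)
have lt_bT : b < #|T| by nia.
have degC x : x \in ~: T -> deg_in G (~: T) x <= #|~: T|.-1.
  move=> xT.
  rewrite /deg_in (bigD1 x) //= adj_irr add0n (cardsD1 x (~: T)) xT /=.
  rewrite -sum1_card [leqRHS](eq_bigl (fun y => (y \in ~: T) && (y != x))).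
    by apply: leq_sum => y _; case: (G x y).
  by move=> y; rewrite !inE andbC.
(* Edges between [T] and its complement are charged to [T]; the rest of the complement is at most
   complete. *)
have sum_le : \sum_x degree G x
    <= #|~: T| * #|~: T|.-1 + 2 * \sum_(x in T) degree G x.
  rewrite (bigID (mem T)) /= mul2n -addnn addnCA leq_add2l.
  have -> : \sum_(x | x \notin T) degree G x = \sum_(x in ~: T) degree G x.
    by apply: eq_bigl => x; rewrite inE.
  rewrite -(eq_bigr _ (fun x _ => degree_deg_in G T x)) big_split /= addnC.
  rewrite -sum_nat_const leq_add ?leq_sum //.
  rewrite (sum_deg_in_sym _ _ (adj_sym G)); apply: leq_sum => x _.
  by rewrite -(degree_deg_in G T) leq_addl.
have bin2E m : 2 * 'C(m, 2) = m * m.-1 by rewrite -mul_bin_diag bin1.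
move: sumG; rewrite !mulnDr bin2E => sumG.
have lt_bS : b * #|S| < a * #|T| by lia.
have := @edge_count_lt (Z.of_nat a) (Z.of_nat b) (Z.of_nat #|V|) (Z.of_nat #|S|)
  (Z.of_nat #|T|).
have zE : (Z.of_nat ((#|V| - b - 1) * (#|V| - b - 1).-1)
    = (Z.of_nat #|V| - Z.of_nat b - 1) * (Z.of_nat #|V| - Z.of_nat b - 2))%Z.
  by rewrite Nat2Z.inj_mul; f_equal; lia.
have zT : (Z.of_nat (#|~: T| * #|~: T|.-1)
    = (Z.of_nat #|V| - Z.of_nat #|T|) * (Z.of_nat #|V| - Z.of_nat #|T| - 1))%Z.
  (* At 0 the truncated predecessor differs from the integer one, but both products vanish. *)
  rewrite -cT; case: #|~: T| => [|u]; first by rewrite mul0n addn0 Z.sub_diag.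
  by rewrite Nat2Z.inj_mul; f_equal; lia.
by lia.
Qed.

Theorem theorem1p6 (a b k : nat) (V : finType) (G : sgraph V)
  (ha : 1 <= a) (hab : a < b)
  (hconn : connected G)
  (hn : (4 * a%:R + 5 * b%:R / 2 + 4 * k%:R + 7
           <= #|V|%:R :> rat)%R)
  (hdelta : a + k <= min_degree G)
  (he : 'C(#|V| - b - 1, 2) + a * b + 2 * a + (b + 1) * k <= #|edges G|) :
  critical a b k G.
Proof.
move=> X cardX.
have {}hn : 8 * a + 5 * b + 8 * k + 14 <= 2 * #|V|.
  by rewrite -(Num.Theory.ler_nat rat); lra.
have cardG' : #|{: {x : V | x \notin X}}| = #|V| - k.
  by rewrite -(card_deleted X) cardX addnK.
apply: factor_of_many_edges => //; rewrite ?[#|_|]cardG'.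
- by lia.
- move=> u; rewrite -(leq_add2r (deg_in G X (val u))) -degree_deleted.
  apply: leq_trans (degree_le_min G (val u)); apply: leq_trans hdelta.
  rewrite leq_add2l -cardX -sum1_card.
  by apply: leq_sum => y _; case: (G _ y).
have bin2E m : 2 * 'C(m, 2) = m * m.-1 by rewrite -mul_bin_diag bin1.
have le_edges := double_edges_le G; have le_sum := sum_degree_deleted G X.
have {}he := leq_mul (leqnn 2) he.
rewrite cardX in le_sum; rewrite !mulnDr bin2E in he; rewrite !mulnDr bin2E.
(* Writing [#|V|] through [m] removes truncated subtraction. The loss in [le_sum] then equals the
   drop of the doubled edge bound from [k] to 0 exactly. *)
have [m Vm] : exists m, #|V| = m + k + b + 2.
  by exists (#|V| - k - b - 2); lia.
rewrite {}Vm in he le_sum *.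
have E1 : m + k + b + 2 - k - b - 1 = m.+1 by lia.
have E2 : m + k + b + 2 - b - 1 = (m + k).+1 by lia.
have E3 : m + k + b + 2 - k = m + b + 2 by lia.
have E4 : m + k + b + 2 - 1 = m + k + b + 1 by lia.
rewrite E1 succnK; rewrite E2 succnK in he; rewrite E3 E4 in le_sum.
move: le_sum le_edges he; move: (\sum_u _) (\sum_x _) #|edges G| => s t e.
by lia.
Qed.
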